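(* Let $N\in\mathbb{N}$, $N\ge 1$, let $X=\{x_1<x_2<\dots<x_N\}\subset(0,1)$ and let $\varepsilon>0$. Let $x_0:=0$, $x_{N+1}:=1$, and for $x\in(0,1)$ define $$x^-:=\max\{x_i:\ x_i\le x,\ 0\le i\le N\},\qquad x^+:=\min\{x_i:\ x\le x_i,\ 1\le i\le N+1\}.$$ Then the power function satisfies $$P_{1,\varepsilon,X}(x)=\sqrt{\frac{\sinh(\varepsilon(x-x^-))\,\sinh(\varepsilon(x^+-x))}{\varepsilon\,\sinh(\varepsilon(x^+-x^-))}},\qquad x\in(0,1),$$ where for $x\in X$ (in which case $x^-=x^+=x$) the right-hand side is understood as $0$.
   Context: For $\varepsilon>0$ the Brownian Bridge kernel $k_{1,\varepsilon}:(0,1)^2\to\mathbb{R}$ is $$k_{1,\varepsilon}(x,y)=\frac{\sinh(\varepsilon\min(x,y))\,\sinh(\varepsilon(1-\max(x,y)))}{\varepsilon\sinh(\varepsilon)},\quad x,y\in(0,1).$$ It is strictly positive definite on $(0,1)$. The cardinal (Lagrange) basis of $V_{1,\varepsilon}(X)=\operatorname{span}\{k_{1,\varepsilon}(\cdot,x):x\in X\}$ is the family of unique elements $\ell_{1,\varepsilon,i}\in V_{1,\varepsilon}(X)$, $1\le i\le N$, with $\ell_{1,\varepsilon,i}(x_j)=\delta_{ij}$ for $1\le i,j\le N$. The power function $P_{1,\varepsilon,X}:(0,1)\to[0,\infty)$ is defined by $$P_{1,\varepsilon,X}(x)^2:=k_{1,\varepsilon}(x,x)-\sum_{i=1}^N\ell_{1,\varepsilon,i}(x)\,k_{1,\varepsilon}(x,x_i),\quad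 x\in(0,1).$$ *)

(* Defs.v *)
(* MathComp-Analysis, over an arbitrary R : realType. *)
From HB Require Import structures.
From mathcomp Require Import all_boot all_order all_algebra.
From mathcomp Require Import all_classical all_reals all_analysis.

Set Implicit Arguments.
Unset Strict Implicit.
Unset Printing Implicit Defensive.

Import Order.TTheory GRing.Theory Num.Theory.

Local Open Scope classical_set_scope.
Local Open Scope ring_scope.

Definition sinh {R : realType} (t : R) : R := (expR t - expR (- t)) / 2.

(* Functions on (0, 1) are represented by functions R -> R of which only the
   values on (0, 1) matter: every condition below is restricted to (0, 1). *)
Definition bb_kernel {R : realType} (eps s t : R) : R :=
  sinh (eps * Num.min s t) * sinh (eps * (1 - Num.max s t))
    / (eps * sinh eps).

Definition kernel_span {R : realType} (eps : R) (N : nat) (x : 'I_N -> R) :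
    set (R -> R) :=
  [set f | exists c : 'I_N -> R, forall t, 0 < t < 1 ->
     f t = \sum_(j < N) c j * bb_kernel eps t (x j)].

(* The element of the span with value 1 at x i and 0 at the other x j. It is
   unique on (0, 1) since the kernel is strictly positive definite; the default
   value 0 would be returned only if there were no such element. *)
Definition cardinal_basis {R : realType} (eps : R) (N : nat) (x : 'I_N -> R)
    (i : 'I_N) : R -> R :=
  xget (fun=> 0) [set l | kernel_span eps x l /\
                          forall j : 'I_N, l (x j) = (i == j)%:R].

(* The nonnegative function whose square is the given expression; the default
   value 0 would be returned only if that expression were negative somewhere
   on (0, 1). *)
Definition power_function {R : realType} (eps : R) (N : nat) (x : 'I_N -> R) :
    R -> R :=
  xget (fun=> 0) [set P | forall t, 0 < t < 1 ->
    0 <= P t /\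
    P t ^+ 2 = bb_kernel eps t t
      - \sum_(i < N) cardinal_basis eps x i t * bb_kernel eps t (x i)].

(* For points x i and t in (0, 1), the neutral element 0 (resp. 1) plays the
   role of the additional node x_0 = 0 (resp. x_{N+1} = 1), which always
   belongs to the set whose maximum (resp. minimum) is taken. *)
Definition node_below {R : realType} (N : nat) (x : 'I_N -> R) (t : R) : R :=
  \big[Num.max/0]_(i < N | x i <= t) x i.

Definition node_above {R : realType} (N : nat) (x : 'I_N -> R) (t : R) : R :=
  \big[Num.min/1]_(i < N | t <= x i) x i.

(* Main.v *)
(* Between two consecutive nodes a < b (0 and 1 being added to the nodes) every
   kernel translate, hence every l_i, is a combination of sinh(eps (b - t)) and
   sinh(eps (t - a)), so it is determined by its values at a and b. As
   sum_i l_i(s) k(t, x_i) = k(t, s) at every s that is a node, 0 or 1, the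
   square of the power function at t becomes
     k(t,t) - (k(t,a) sinh(eps(b-t)) + k(t,b) sinh(eps(t-a))) / sinh(eps(b-a)),
   which the three-term identity for sinh reduces to the claimed product. *)
Require Import Defs.
From HB Require Import structures.
From mathcomp Require Import all_boot all_order all_algebra.
From mathcomp Require Import all_classical all_reals all_analysis.
From mathcomp Require Import ring lra.

Set Implicit Arguments.
Unset Strict Implicit.
Unset Printing Implicit Defensive.

Import Order.TTheory GRing.Theory Num.Theory.

Local Open Scope ring_scope.

(** * Hyperbolic sine and its three-term relation *)

Section Sinh.
Variable R : realType.
Implicit Types a b c d eps : R.

Lemma sinh0 : sinh (0 : R) = 0.
Proof. by rewrite /sinh oppr0 subrr mul0r. Qed.

Lemma sinh_gt0 a : 0 < a -> 0 < sinh a.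
Proof. by move=> a0; rewrite divr_gt0// subr_gt0 ltr_expR; lra. Qed.

Lemma sinhB a b : sinh (a - b) = (expR a * expR (- b) - expR b * expR (- a)) / 2.
Proof. by rewrite /sinh opprB !expRD. Qed.

(** By [sinhB], sinh (a - b) is half the determinant of the vectors (exp a, exp (- a)) and (exp b,
    exp (- b)), so this is the Plücker relation for four vectors in the plane. *)
Lemma sinhB_plucker a b c d :
  sinh (a - b) * sinh (c - d) =
  sinh (a - d) * sinh (c - b) + sinh (a - c) * sinh (b - d).
Proof. by rewrite !sinhB; field. Qed.

Lemma sinhMB_plucker eps a b c d :
  sinh (eps * (a - b)) * sinh (eps * (c - d)) =
  sinh (eps * (a - d)) * sinh (eps * (c - b))
  + sinh (eps * (a - c)) * sinh (eps * (b - d)).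
Proof. by rewrite !mulrBr sinhB_plucker. Qed.

End Sinh.

(** * Two-point interpolation of the kernel *)

Section Kernel.
Variables (R : realType) (eps : R).
Hypothesis eps_gt0 : 0 < eps.
Implicit Types s t y a b : R.

Lemma bb_kernelC s t : bb_kernel eps s t = bb_kernel eps t s.
Proof. by rewrite /bb_kernel minC maxC. Qed.

Lemma bb_kernel_le s t : s <= t ->
  bb_kernel eps s t =
  sinh (eps * s) * sinh (eps * (1 - t)) / (eps * sinh eps).
Proof. by move=> st; rewrite /bb_kernel min_l // max_r. Qed.

Lemma bb_kernel0 t : 0 <= t -> bb_kernel eps 0 t = 0.
Proof. by move=> t0; rewrite bb_kernel_le // mulr0 sinh0 !mul0r. Qed.

Lemma bb_kernel1 t : t <= 1 -> bb_kernel eps 1 t = 0.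
Proof.
by move=> t1; rewrite bb_kernelC bb_kernel_le // subrr mulr0 sinh0 mulr0 mul0r.
Qed.

Lemma sinhMB_gt0 a b : a < b -> 0 < sinh (eps * (b - a)).
Proof. by move=> ab; rewrite sinh_gt0 // mulr_gt0 // subr_gt0. Qed.

Lemma kernel_denom_neq0 : (eps != 0) && (sinh eps != 0).
Proof. by rewrite !gt_eqF // sinh_gt0. Qed.

(** On [a, b] the translate at [y] is a multiple of sinh (eps (1 - t)) if [y <= a], and of sinh (eps
    t) if [b <= y]. The Plücker relation for a, b, t and the fourth point 1, resp. 0, expands it. *)
Lemma bb_kernel_interp a b t y : a <= t <= b -> (y <= a) || (b <= y) ->
  bb_kernel eps t y * sinh (eps * (b - a)) =
  bb_kernel eps a y * sinh (eps * (b - t))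
  + bb_kernel eps b y * sinh (eps * (t - a)).
Proof.
move=> /andP[at_ tb] /orP[ya|by_].
- rewrite !(bb_kernelC _ y) !bb_kernel_le; [|lra..].
  have := sinhMB_plucker eps 1 t b a.
  set k := (eps * sinh eps)^-1 => H.
  transitivity (sinh (eps * y) * k *
    (sinh (eps * (1 - t)) * sinh (eps * (b - a)))); first by ring.
  by rewrite H; ring.
- rewrite !bb_kernel_le; [|lra..].
  have := sinhMB_plucker eps b a t 0; rewrite !subr0.
  set k := (eps * sinh eps)^-1 => H.
  transitivity (sinh (eps * (1 - y)) * k *
    (sinh (eps * (b - a)) * sinh (eps * t))); first by ring.
  by rewrite H; ring.
Qed.

Lemma bb_kernel_residual a b t : a < t < b ->
  bb_kernel eps t t
  - (bb_kernel eps t a * sinh (eps * (b - t))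
     + bb_kernel eps t b * sinh (eps * (t - a))) / sinh (eps * (b - a)) =
  sinh (eps * (t - a)) * sinh (eps * (b - t))
  / (eps * sinh (eps * (b - a))).
Proof.
move=> /andP[at_ tb].
have /andP[e0 se0] := kernel_denom_neq0.
have sba : sinh (eps * (b - a)) != 0 by rewrite gt_eqF // sinhMB_gt0 //; lra.
rewrite (bb_kernelC t a) !bb_kernel_le; [|lra..].
have := sinhMB_plucker eps 1 t b 0; have := sinhMB_plucker eps b a t 0.
rewrite !subr0 mulr1.
move: (sinh (eps * (b - a))) sba (sinh eps) se0 => D D0 E E0.
move: (sinh (eps * t)) (sinh (eps * a)) (sinh (eps * b)) => pt pa pb.
move: (sinh (eps * (1 - t))) (sinh (eps * (1 - b))) => qt qb.
move: (sinh (eps * (t - a))) (sinh (eps * (b - t))) => dta dbt H1 H2.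
(* [H1] expands [D * pt], whose [pa * dbt] part cancels; then [H2] turns [qt * pb - qb * pt] into
   [E * dbt]. *)
transitivity ((qt * (D * pt) - pa * qt * dbt - pt * qb * dta) / (eps * E * D)).
  by field; rewrite e0 E0 D0.
transitivity (dta * (qt * pb - qb * pt) / (eps * E * D)); first by rewrite H1; ring.
by rewrite H2; field; rewrite e0 E0 D0.
Qed.

(** * Independence of the kernel translates and the cardinal basis *)

Section Nodes.
Variables (N : nat) (x : 'I_N -> R).
Hypothesis x_incr : forall i j : 'I_N, (i < j)%N -> x i < x j.
Hypothesis x_mem : forall i : 'I_N, 0 < x i < 1.

Let kcomb (c : 'I_N -> R) s := \sum_(j < N) c j * bb_kernel eps s (x j).

Let extended_node a := [\/ a = 0, a = 1 | exists i, a = x i].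

Lemma kcomb0 c : kcomb c 0 = 0.
Proof.
rewrite /kcomb big1 // => j _; rewrite bb_kernel0 ?mulr0 //.
by have /andP[/ltW] := x_mem j.
Qed.

Lemma kcomb1 c : kcomb c 1 = 0.
Proof.
rewrite /kcomb big1 // => j _; rewrite bb_kernel1 ?mulr0 //.
by have /andP[_ /ltW] := x_mem j.
Qed.

(** The witness is the preceding node or, for the first node, the boundary point 0, where all
    translates vanish. *)
Lemma kcomb_pred_node c i : (forall j, kcomb c (x j) = 0) ->
  exists y, [/\ 0 <= y < x i, kcomb c y = 0 & forall j : 'I_N, (j < i)%N -> x j <= y].
Proof.
move=> c0; have /andP[xi0 _] := x_mem i.
case: i xi0 => [[|n] nN] /= xi0; first by exists 0; rewrite lexx kcomb0.
exists (x (Ordinal (ltnW nN))); split => //.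
  by rewrite x_incr // andbT; have /andP[/ltW] := x_mem (Ordinal (ltnW nN)).
move=> j; rewrite ltnS leq_eqVlt => /orP[/eqP jn|jn]; last exact/ltW/x_incr.
by rewrite (_ : j = Ordinal (ltnW nN)) //; apply: val_inj.
Qed.

(* The tail of c is eliminated from the right: the combination below of the
   values of kcomb c at x i and at the preceding node kills every term j < i. *)
Lemma kcomb_inj c : (forall j, kcomb c (x j) = 0) -> forall i, c i = 0.
Proof.
move=> c0 i.
(* Induction on a bound for [N - i]: the last node is treated first, and [n = 0] is vacuous. *)
have [n] : exists n, (N <= i + n)%N by exists N; rewrite leq_addl.
elim: n i => [|n IH] i; first by rewrite addn0 leqNgt ltn_ord.
rewrite addnS => hi.
have cgt (j : 'I_N) : (i < j)%N -> c j = 0.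
  by move=> ij; apply: IH; rewrite (leq_trans hi) // -addSn leq_add2r.
have [y [/andP[y0 yi] Fy jy]] := kcomb_pred_node i c0.
have /andP[xi0 xi1] := x_mem i.
have : sinh (eps * (1 - y)) * kcomb c (x i) - sinh (eps * (1 - x i)) * kcomb c y = 0.
  by rewrite Fy c0 !mulr0 subr0.
rewrite /kcomb !mulr_sumr -sumrB (bigD1 i) //= big1 => [|j ji]; last first.
  have [lji|] := ltnP j i.
    have xy := jy _ lji.
    by rewrite !(bb_kernelC _ (x j)) !bb_kernel_le; [ring|lra|lra].
  by rewrite leq_eqVlt eq_sym (inj_eq val_inj) (negbTE ji) /= => /cgt->; ring.
rewrite addr0 !bb_kernel_le; [|lra..].
(* The difference left in the factor of [c i] equals sinh eps * sinh (eps (x i - y)), so that factor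
   is positive. *)
have := sinhMB_plucker eps 1 y (x i) 0; rewrite !subr0 mulr1 => H.
set k := (eps * sinh eps)^-1.
have -> : sinh (eps * (1 - y)) * (c i * (sinh (eps * x i) * sinh (eps * (1 - x i)) * k))
   - sinh (eps * (1 - x i)) * (c i * (sinh (eps * y) * sinh (eps * (1 - x i)) * k))
  = c i * (sinh (eps * (1 - x i)) * k *
     (sinh (eps * (1 - y)) * sinh (eps * x i) - sinh (eps * (1 - x i)) * sinh (eps * y))).
  by ring.
rewrite H addrK => /eqP; rewrite mulf_eq0 => /orP[/eqP//|].
have s1 := sinhMB_gt0 xi1; have s2 := sinhMB_gt0 yi.
have s := sinh_gt0 eps_gt0.
by rewrite gt_eqF //; do 2![apply: mulr_gt0 => //]; rewrite ?invr_gt0; exact: mulr_gt0.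
Qed.

(** A vector in the left kernel of the Gram matrix gives a combination vanishing at all nodes, so
    [kcomb_inj] makes the matrix invertible; the rows of its inverse are the coefficients. *)
Lemma exists_cardinal_coef :
  exists B : 'M[R]_N, forall i j, kcomb (B i) (x j) = (i == j)%:R.
Proof.
pose G := \matrix_(i < N, j < N) bb_kernel eps (x i) (x j).
have Gfree : row_free G.
  apply: inj_row_free => v vG; apply/rowP => i; rewrite mxE.
  apply: (@kcomb_inj (v 0)) => j.
  move/rowP: vG => /(_ j); rewrite !mxE => <-.
  by apply: eq_bigr => l _; rewrite !mxE bb_kernelC.
have /row_freeP[B /mulmx1C BG] := Gfree.
exists B => i j; move/matrixP: BG => /(_ i j); rewrite !mxE => <-.
by apply: eq_bigr => l _; rewrite !mxE bb_kernelC.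
Qed.

Lemma cardinal_basisP i :
  kernel_span eps x (cardinal_basis eps x i) /\
  forall j, cardinal_basis eps x i (x j) = (i == j)%:R.
Proof.
have [B BE] := exists_cardinal_coef.
apply: (@xgetPex _ (fun=> 0) [set l | kernel_span eps x l /\
  forall j : 'I_N, l (x j) = (i == j)%:R]%classic).
by exists (kcomb (B i)); split => [|j]; [exists (B i) | rewrite BE].
Qed.

(** Membership in the span fixes a function only on (0, 1); the combinations [kcomb (C i)] also have
    known values at 0 and 1, which may be the ends of the interval around [t]. *)
Lemma cardinal_basis_coef :
  exists C : 'I_N -> 'I_N -> R,
   (forall i t, 0 < t < 1 -> cardinal_basis eps x i t = kcomb (C i) t) /\
   forall i j, kcomb (C i) (x j) = (i == j)%:R.
Proof.
have /(_ _)/cid h i := (cardinal_basisP i).1.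
exists (fun i => sval (h i)); split=> [i|i j]; first exact: (svalP (h i)).
by rewrite /kcomb -(svalP (h i)) // (cardinal_basisP i).2.
Qed.

Lemma kcomb_interp c a b t : a < t < b ->
  (forall j, (x j <= a) || (b <= x j)) ->
  kcomb c t = (kcomb c a * sinh (eps * (b - t))
    + kcomb c b * sinh (eps * (t - a))) / sinh (eps * (b - a)).
Proof.
move=> /andP[at_ tb] hab.
have sba : sinh (eps * (b - a)) != 0 by rewrite gt_eqF // sinhMB_gt0 //; lra.
apply: (canRL (mulfK sba)); rewrite /kcomb !mulr_suml -big_split /=.
apply: eq_bigr => j _; rewrite -[LHS]mulrA bb_kernel_interp ?hab ?(ltW at_) ?ltW //.
by ring.
Qed.

(** * The square of the power function *)

Let power2 t := bb_kernel eps t t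
  - \sum_(i < N) cardinal_basis eps x i t * bb_kernel eps t (x i).

Lemma power2_node i : power2 (x i) = 0.
Proof.
rewrite /power2 (bigD1 i) //= big1 => [|j ji]; rewrite (cardinal_basisP _).2.
  by rewrite eqxx mul1r addr0 subrr.
by rewrite (negbTE ji) mul0r.
Qed.

Lemma power2_between a b t : extended_node a -> extended_node b ->
  0 < t < 1 -> a < t < b -> (forall j, (x j <= a) || (b <= x j)) ->
  power2 t = sinh (eps * (t - a)) * sinh (eps * (b - t))
    / (eps * sinh (eps * (b - a))).
Proof.
move=> ea eb t01 tab hab; rewrite /power2 -bb_kernel_residual //.
have [C [CE Cx]] := cardinal_basis_coef.
have repr s : extended_node s ->
    \sum_(i < N) kcomb (C i) s * bb_kernel eps t (x i) = bb_kernel eps t s.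
  case=> [->|->|[j ->]].
  - rewrite big1 => [|i _]; last by rewrite kcomb0 mul0r.
    by rewrite bb_kernelC bb_kernel0 //; lra.
  - rewrite big1 => [|i _]; last by rewrite kcomb1 mul0r.
    by rewrite bb_kernelC bb_kernel1 //; lra.
  - rewrite (bigD1 j) //= big1 => [|i ij]; rewrite Cx.
      by rewrite eqxx mul1r addr0.
    by rewrite (negbTE ij) mul0r.
(* Using [repr] backwards turns both sides into sums weighted by [bb_kernel eps t (x i)], compared
   termwise by [kcomb_interp]. *)
congr (_ - _); rewrite -(repr a) // -(repr b) // !mulr_suml -big_split mulr_suml /=.
apply: eq_bigr => i _; rewrite CE // (kcomb_interp _ tab hab); ring.
Qed.

Lemma extended_node_below t : extended_node (node_below x t).
Proof.
rewrite /node_below; elim/big_ind: _ => [|u v hu hv|i _].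
- exact: Or31.
- by case: (leP u v).
- by apply: Or33; exists i.
Qed.

Lemma extended_node_above t : extended_node (node_above x t).
Proof.
rewrite /node_above; elim/big_ind: _ => [|u v hu hv|i _].
- exact: Or32.
- by case: (leP u v).
- by apply: Or33; exists i.
Qed.

Lemma node_below_above t : 0 < t < 1 -> (forall i, x i != t) ->
  node_below x t < t < node_above x t /\
  forall j, (x j <= node_below x t) || (node_above x t <= x j).
Proof.
move=> /andP[t0 t1] xt; split=> [|j].
  apply/andP; split; rewrite /node_below /node_above.
    elim/big_ind: _ => // [u v ut vt|i xit]; first by rewrite gt_max ut vt.
    by rewrite lt_neqAle xt.
  elim/big_ind: _ => // [u v ut vt|i xit]; first by rewrite lt_min ut vt.
  by rewrite lt_neqAle eq_sym xt.
have [xjt|/ltW txj] := leP (x j) t; apply/orP; [left|right].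
  by rewrite /node_below le_bigmax_cond.
by rewrite /node_above bigmin_le_cond.
Qed.

Lemma power2E t : 0 < t < 1 -> (forall i, x i != t) ->
  power2 t = sinh (eps * (t - node_below x t))
               * sinh (eps * (node_above x t - t))
               / (eps * sinh (eps * (node_above x t - node_below x t))).
Proof.
move=> t01 xt; have [tab hab] := node_below_above t01 xt.
apply: power2_between => //.
  exact: extended_node_below.
exact: extended_node_above.
Qed.

(** This makes the square root of [power2] an admissible choice in [power_function], which therefore
    does not take its default value. *)
Lemma power2_ge0 t : 0 < t < 1 -> 0 <= power2 t.
Proof.
move=> t01; have [/existsP[i /eqP<-]|/existsPn xt] := boolP [exists i, x i == t].
  by rewrite power2_node.
have [/andP[bt ta] _] := node_below_above t01 xt.
rewrite power2E //; apply/ltW/divr_gt0; apply: mulr_gt0 => //; apply: sinhMB_gt0 => //.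
exact: lt_trans ta.
Qed.

Lemma power_functionE t : 0 < t < 1 -> power_function eps x t = Num.sqrt (power2 t).
Proof.
move=> t01; pose S := [set P : R -> R | forall t, 0 < t < 1 ->
  0 <= P t /\ P t ^+ 2 = power2 t]%classic.
have : S (power_function eps x).
  apply: xgetPex; exists (fun s => Num.sqrt (power2 s)) => s s01.
  by rewrite sqrtr_ge0 sqr_sqrtr // power2_ge0.
by move=> /(_ t t01)[P0 <-]; rewrite sqrtr_sqr ger0_norm.
Qed.

End Nodes.
End Kernel.

Theorem proposition4 (R : realType) (N : nat) (hN : (1 <= N)%N)
    (x : 'I_N -> R)
    (hx_incr : forall i j : 'I_N, (i < j)%N -> x i < x j)
    (hx_mem : forall i : 'I_N, 0 < x i < 1)
    (eps : R) (heps : 0 < eps) (t : R) (ht : 0 < t < 1) :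
  power_function eps x t =
    if [exists i : 'I_N, x i == t] then 0
    else Num.sqrt (sinh (eps * (t - node_below x t))
                     * sinh (eps * (node_above x t - t))
                     / (eps * sinh (eps * (node_above x t - node_below x t)))).
Proof.
rewrite power_functionE //; have [/existsP[i /eqP<-]|/existsPn xt] := ifPn.
  by rewrite power2_node // sqrtr0.
by rewrite power2E.
Qed.
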